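(* Let $\mathcal{C}$ be a small category. Let $\mathbf{SatCvg}(\mathcal{C})$ and $\mathbf{GroCvg}(\mathcal{C})$ be the posets of saturated coverages and of Grothendieck coverages on $\mathcal{C}$, both ordered by inclusion $\subseteq$. The maps of posets $$\overline{(-)} : \mathbf{SatCvg}(\mathcal{C}) \to \mathbf{GroCvg}(\mathcal{C}), \quad j \mapsto \overline{j}, \qquad (-)^\circ : \mathbf{GroCvg}(\mathcal{C}) \to \mathbf{SatCvg}(\mathcal{C}), \quad J \mapsto J^\circ$$ form an isomorphism of posets (they are mutually inverse).
   Context: A family over $U \in \mathcal{C}$ is a set $r = \{r_i : U_i \to U\}_{i \in I}$ of morphisms with codomain $U$; $(f)$ denotes the singleton family. For $g : V \to U$ and a family $t = \{t_j : V_j \to V\}$, set $g_*(t) = \{g t_j : V_j \to U\}$. For families $r$, $t$ over $U$, write $r \leq t$ if every element of $r$ factors through some element of $t$. A collection of families $j$ assigns to each $U$ a set $j(U)$ of families over $U$. It is a coverage if $(1_U) \in j(U)$ for all $U$ and, for every $r \in j(U)$ and $g : V \to U$, there is $t \in j(V)$ with $g_*(t) \leq r$. A coverage $j$ is composition closed if whenever $r = \{r_i : U_i \to U\} \in j(U)$ and $t^i \in j(U_i)$ for each $i$, then $\bigcup_i (r_i)_*(t^i) \in j(U)$. It is refinement closed if whenever $r \in j(U)$ and $t$ is a family over $U$ with $r \leq t$, then $t \in j(U)$. It is saturated if it is both composition closed and refinement closed. A sieve over $U$ is a family over $U$ closed under precomposition; equivalently a subpresheaf of the representable $y(U)$; $y(U)$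 itself denotes the maximal sieve. For a sieve $R$ over $U$ and $g : V \to U$, $g^*(R) = \{f : W \to V \mid gf \in R\}$. A Grothendieck coverage $J$ on $\mathcal{C}$ is a collection of families all of whose members are sieves such that (G1) $y(U) \in J(U)$ for all $U$; (G2) if $R \in J(U)$ and $g : V \to U$, then $g^*(R) \in J(V)$; (G3) if $R \in J(U)$, $R'$ is a sieve on $U$, and $g^*(R') \in J(V)$ for every $g : V \to U$ in $R$, then $R' \in J(U)$. For a family $r$ over $U$, $\overline{r}$ denotes the sieve of all morphisms into $U$ that factor through some element of $r$. For a coverage $j$, $\overline{j}(U) = \{\overline{r} \mid r \in j(U)\}$. For a Grothendieck coverage $J$, $J^\circ(U)$ is the set of families $r$ over $U$ with $\overline{r} \in J(U)$. $j \subseteq j'$ means $j(U) \subseteq j'(U)$ for all $U$. *)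

(* Defs.v *)
From HB Require Import structures.
From mathcomp Require Import all_boot all_order.
From mathcomp Require Import boolp classical_sets.

Set Implicit Arguments.
Unset Strict Implicit.
Unset Printing Implicit Defensive.

Local Open Scope classical_set_scope.

Record category := Category {
  Ob :> Type;
  Hom : Ob -> Ob -> Type;
  idmap : forall U : Ob, Hom U U;
  compose : forall W V U : Ob, Hom V U -> Hom W V -> Hom W U;
  compose1m : forall (V U : Ob) (f : Hom V U), compose (idmap U) f = f;
  composem1 : forall (V U : Ob) (f : Hom V U), compose f (idmap V) = f;
  composeA : forall (X W V U : Ob) (f : Hom V U) (g : Hom W V) (h : Hom X W),
    compose f (compose g h) = compose (compose f g) h
}.

Arguments Hom {c} V U : rename.
Arguments idmap {c} U : rename.
Arguments compose {c W V U} f g : rename.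

Definition over (C : category) (U : C) := {V : C & Hom V U}.

Definition mk_over (C : category) (U V : C) (f : Hom V U) : over U :=
  existT (fun V => Hom V U) V f.

Definition dom (C : category) (U : C) (f : over U) : C := projT1 f.

Definition arr (C : category) (U : C) (f : over U) : Hom (dom f) U := projT2 f.

Definition postcomp (C : category) (U V : C) (g : Hom V U) (f : over V) :
  over U := mk_over (compose g (arr f)).

Definition family_over (C : category) (U : C) := set (over U).

Definition collection (C : category) := forall U : C, set (family_over U).

Section Families.
Variable C : category.
Implicit Types (U V : C) (j J : collection C).

Definition pushforward U V (g : Hom V U) (t : family_over V) : family_over U :=
  [set postcomp g f | f in t].

Definition factors_through U (f g : over U) : Prop :=
  exists h : Hom (dom f) (dom g), arr f = compose (arr g) h.

Definition refines U (r t : family_over U) : Prop :=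
  forall f, r f -> exists2 g, t g & factors_through f g.

Definition is_coverage j : Prop :=
  (forall U, j U [set mk_over (idmap U)]) /\
  (forall U V (r : family_over U) (g : Hom V U), j U r ->
     exists2 t : family_over V, j V t & refines (pushforward g t) r).

(* A family over [U] is a set of morphisms, hence indexed by its own elements.
   Only the values [t f] with [r f] matter. *)
Definition composition_closed j : Prop :=
  forall U (r : family_over U) (t : forall f : over U, family_over (dom f)),
    j U r -> (forall f, r f -> j (dom f) (t f)) ->
    j U (\bigcup_(f in r) pushforward (arr f) (t f)).

Definition refinement_closed j : Prop :=
  forall U (r t : family_over U), j U r -> refines r t -> j U t.

Definition saturated j : Prop := composition_closed j /\ refinement_closed j.

Definition is_sieve U (R : family_over U) : Prop :=
  forall (f : over U) W (h : Hom W (dom f)),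
    R f -> R (mk_over (compose (arr f) h)).

Definition maximal_sieve U : family_over U := setT.
Arguments maximal_sieve U _ : clear implicits.

Definition pullback_sieve U V (g : Hom V U) (R : family_over U) :
  family_over V :=
  postcomp g @^-1` R.

Definition is_grothendieck J : Prop :=
  [/\ forall U (R : family_over U), J U R -> is_sieve R,
      forall U, J U (maximal_sieve U),
      forall U V (R : family_over U) (g : Hom V U),
        J U R -> J V (pullback_sieve g R)
    & forall U (R R' : family_over U), J U R -> is_sieve R' ->
        (forall V (g : Hom V U), R (mk_over g) -> J V (pullback_sieve g R')) ->
        J U R'].

Definition generated_sieve U (r : family_over U) : family_over U :=
  [set f | exists2 g, r g & factors_through f g].

Definition sieve_closure j : collection C :=
  fun U => [set generated_sieve r | r in j U].

Definition generating_families J : collection C :=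
  fun U => [set r | J U (generated_sieve r)].

Definition subcollection j j' : Prop := forall U, j U `<=` j' U.

End Families.

Arguments maximal_sieve {C} U _.
Arguments sieve_closure {C} j U _.
Arguments generating_families {C} J U _.

Record SatCvg (C : category) := MkSatCvg {
  satcvg_collection :> collection C;
  satcvg_coverage : is_coverage satcvg_collection;
  satcvg_saturated : saturated satcvg_collection
}.

Record GroCvg (C : category) := MkGroCvg {
  grocvg_collection :> collection C;
  grocvg_grothendieck : is_grothendieck grocvg_collection
}.

Lemma subcollection_refl (C : category) (j : collection C) :
  subcollection j j.
Proof. by move=> U r. Qed.

Lemma subcollection_trans (C : category) (j2 j1 j3 : collection C) :
  subcollection j1 j2 -> subcollection j2 j3 -> subcollection j1 j3.
Proof. by move=> j12 j23 U r /j12 /j23. Qed.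

Lemma subcollection_anti (C : category) (j j' : collection C) :
  subcollection j j' -> subcollection j' j -> j = j'.
Proof.
move=> jj' j'j; apply: functional_extensionality_dep => U.
by apply/seteqP; split; [exact: jj' | exact: j'j].
Qed.

Lemma satcvg_inj (C : category) : injective (@satcvg_collection C).
Proof.
move=> [j cj sj] [j' cj' sj'] /= jj'; rewrite -{}jj' in cj' sj' *.
by rewrite (Prop_irrelevance cj cj') (Prop_irrelevance sj sj').
Qed.

Lemma grocvg_inj (C : category) : injective (@grocvg_collection C).
Proof.
move=> [J gJ] [J' gJ'] /= JJ'; rewrite -{}JJ' in gJ' *.
by rewrite (Prop_irrelevance gJ gJ').
Qed.

Fact cvg_display : Order.disp_t.
Proof. exact: Order.Disp tt tt. Qed.

Section Posets.
Variable C : category.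

Definition satcvg_le (j j' : SatCvg C) : bool := `[< subcollection j j' >].

Lemma satcvg_le_refl : reflexive satcvg_le.
Proof. by move=> j; apply/asboolP; exact: subcollection_refl. Qed.

Lemma satcvg_le_anti : antisymmetric satcvg_le.
Proof.
move=> j j' /andP[/asboolP jj' /asboolP j'j].
by apply: satcvg_inj; exact: subcollection_anti.
Qed.

Lemma satcvg_le_trans : transitive satcvg_le.
Proof.
move=> j2 j1 j3 /asboolP j12 /asboolP j23; apply/asboolP.
exact: subcollection_trans j12 j23.
Qed.

HB.instance Definition _ := gen_eqMixin (SatCvg C).
HB.instance Definition _ := gen_choiceMixin (SatCvg C).
HB.instance Definition _ := Order.Le_isPOrder.Build cvg_display
  (SatCvg C) satcvg_le_refl satcvg_le_anti satcvg_le_trans.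

Definition grocvg_le (J J' : GroCvg C) : bool := `[< subcollection J J' >].

Lemma grocvg_le_refl : reflexive grocvg_le.
Proof. by move=> J; apply/asboolP; exact: subcollection_refl. Qed.

Lemma grocvg_le_anti : antisymmetric grocvg_le.
Proof.
move=> J J' /andP[/asboolP JJ' /asboolP J'J].
by apply: grocvg_inj; exact: subcollection_anti.
Qed.

Lemma grocvg_le_trans : transitive grocvg_le.
Proof.
move=> J2 J1 J3 /asboolP J12 /asboolP J23; apply/asboolP.
exact: subcollection_trans J12 J23.
Qed.

HB.instance Definition _ := gen_eqMixin (GroCvg C).
HB.instance Definition _ := gen_choiceMixin (GroCvg C).
HB.instance Definition _ := Order.Le_isPOrder.Build cvg_display
  (GroCvg C) grocvg_le_refl grocvg_le_anti grocvg_le_trans.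

End Posets.

(* Main.v *)
From mathcomp Require Import all_boot all_order.
From mathcomp Require Import boolp classical_sets.
Require Import Defs.

(** A family [r] and the sieve it generates refine each other, so a
    refinement-closed collection cannot tell them apart; hence a saturated
    coverage is determined by the sieves it contains.  On sieves, composition
    closure together with refinement closure is (G3), and the coverage axiom
    together with refinement closure is (G2). *)

Set Implicit Arguments.
Unset Strict Implicit.
Unset Printing Implicit Defensive.

Local Open Scope classical_set_scope.

Section Sieves.
Variable C : category.
Implicit Types U V W : C.

Lemma mk_overK U (f : over U) : mk_over (arr f) = f.
Proof. by case: f. Qed.

Lemma factors_through_refl U (f : over U) : factors_through f f.
Proof. by exists (idmap (dom f)); rewrite composem1. Qed.

Lemma factors_through_trans U (g f h : over U) :
  factors_through f g -> factors_through g h -> factors_through f h.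
Proof.
move=> [a fE] [b gE]; exists (compose b a).
by rewrite composeA -gE.
Qed.

Lemma factors_through_postcomp U V (g : Hom V U) (f h : over V) :
  factors_through f h -> factors_through (postcomp g f) (postcomp g h).
Proof. by move=> [a fE]; exists a; rewrite /= fE composeA. Qed.

Lemma sub_refines U (r t : family_over U) : r `<=` t -> refines r t.
Proof. by move=> rt f /rt tf; exists f => //; exact: factors_through_refl. Qed.

Lemma sub_generated U (r : family_over U) : r `<=` generated_sieve r.
Proof. by move=> f rf; exists f => //; exact: factors_through_refl. Qed.

(** Factoring is a preorder on [over U], and [generated_sieve] is down-closure for it, so comparing
    families amounts to comparing down-sets. *)
Lemma refines_generatedE U (r t : family_over U) :
  refines r t <-> generated_sieve r `<=` generated_sieve t.
Proof.
split=> [rt f [g /rt [h th gh] fg]|rt f rf].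
  by exists h => //; exact: factors_through_trans gh.
exact/rt/sub_generated.
Qed.

Lemma sieve_factors U (R : family_over U) (f g : over U) :
  is_sieve R -> R g -> factors_through f g -> R f.
Proof. by move=> sR Rg [a fE]; rewrite -(mk_overK f) fE; exact: sR. Qed.

Lemma is_sieve_generated U (r : family_over U) : is_sieve (generated_sieve r).
Proof.
move=> f W h [g rg fg]; exists g => //.
by apply: factors_through_trans fg; exists h.
Qed.

Lemma generated_sieve_id U (R : family_over U) :
  is_sieve R -> generated_sieve R = R.
Proof.
move=> sR; apply/seteqP; split=> [f [g Rg fg]|]; last exact: sub_generated.
exact: sieve_factors fg.
Qed.

Lemma is_sieve_pullback U V (g : Hom V U) (R : family_over U) :
  is_sieve R -> is_sieve (pullback_sieve g R).
Proof.
move=> sR f W h Rgf; apply: (sieve_factors sR Rgf).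
by exists h; rewrite /= composeA.
Qed.

Lemma pullback_sieve_comp U V W (g : Hom V U) (h : Hom W V)
    (R : family_over U) :
  pullback_sieve (compose g h) R = pullback_sieve h (pullback_sieve g R).
Proof.
by apply/funext => f; rewrite /pullback_sieve /postcomp /preimage /= composeA.
Qed.

Lemma pullback_sieve_mem U V (g : Hom V U) (R : family_over U) :
  is_sieve R -> R (mk_over g) -> pullback_sieve g R = maximal_sieve V.
Proof.
move=> sR Rg; apply/seteqP; split=> // f _.
by apply: (sieve_factors sR Rg); exists (arr f).
Qed.

End Sieves.

Section SaturatedToGrothendieck.
Variables (C : category) (j : collection C).
Hypotheses (cj : is_coverage j) (sj : saturated j).

Lemma saturated_generatedE (U : C) (r : family_over U) :
  j (generated_sieve r) <-> j r.
Proof.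
(* [refines (generated_sieve r) r] unfolds to an identity implication. *)
case: sj => _ rj; split=> /rj; apply; first by move=> f.
exact/sub_refines/sub_generated.
Qed.

(** Reduces (G1)-(G3) for the closure to statements about the sieves lying in [j] itself. *)
Lemma sieve_closureE (U : C) (R : family_over U) :
  sieve_closure j U R <-> is_sieve R /\ j R.
Proof.
split=> [[r jr <-]|[sR jR]].
  by split; [exact: is_sieve_generated | exact/saturated_generatedE].
by exists R => //; exact: generated_sieve_id.
Qed.

Lemma sieve_closure_grothendieck : is_grothendieck (sieve_closure j).
Proof.
case: cj sj => [j1 jpull] [jcomp jref]; split.
- by move=> U R /sieve_closureE[].
- move=> U; apply/sieve_closureE; split=> //.
  by apply: jref (j1 U) _; exact: sub_refines.
- move=> U V R g /sieve_closureE[sR jR]; apply/sieve_closureE.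
  split; first exact: is_sieve_pullback.
  (* (G2): as [R] is a sieve, [g_*(t) <= R] forces [t] to lie inside the pullback of [R]. *)
  have [t jt tR] := jpull _ _ _ g jR.
  apply: jref jt _; apply: sub_refines => f tf.
  have [|h Rh fh] := tR (postcomp g f); first by exists f.
  exact: sieve_factors fh.
- move=> U R R' /sieve_closureE[_ jR] sR' RR'; apply/sieve_closureE.
  (* (G3): composing [R] with the pullbacks of [R'] along its members gives a family in [j]
     contained in [R']. *)
  split=> //; apply: jref (jcomp _ _ (fun f => pullback_sieve (arr f) R') jR _) _.
    by move=> f Rf; have /sieve_closureE[] : sieve_closure j (dom f)
      (pullback_sieve (arr f) R') by apply: RR'; rewrite mk_overK.
  by apply: sub_refines => _ [f _ [h R'fh <-]].
Qed.

End SaturatedToGrothendieck.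

Section GrothendieckToSaturated.
Variables (C : category) (J : collection C).
Hypothesis gJ : is_grothendieck J.

(** Along a member of [R], hence of [R'], the pullback of [R'] is maximal, so (G1) and (G3)
    apply. *)
Lemma grothendieck_superset (U : C) (R R' : family_over U) :
  J R -> is_sieve R' -> R `<=` R' -> J R'.
Proof.
case: gJ => _ G1 _ G3 JR sR' RR'; apply: (G3 _ _ _ JR sR') => V g /RR' R'g.
by rewrite pullback_sieve_mem.
Qed.

Lemma generating_families_coverage : is_coverage (generating_families J).
Proof.
case: gJ => _ G1 G2 _; split=> [U|U V r g Jr].
  rewrite /generating_families /=; suff -> : generated_sieve
    [set mk_over (idmap U)] = maximal_sieve U by exact: G1.
  apply/seteqP; split=> // f _; exists (mk_over (idmap U)) => //.
  by exists (arr f); rewrite compose1m.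
(* The pulled-back sieve serves as the covering family, since it generates itself. *)
exists (pullback_sieve g (generated_sieve r)); last by move=> _ [f rgf <-].
rewrite /generating_families /= generated_sieve_id; first exact: G2.
by apply: is_sieve_pullback; exact: is_sieve_generated.
Qed.

Lemma generating_families_saturated : saturated (generating_families J).
Proof.
case: gJ => _ _ G2 G3; split=> [U r t Jr Jt|U r t Jr /refines_generatedE rt];
  last exact: grothendieck_superset Jr (@is_sieve_generated _ _ _) rt.
(* Composition closure: test the composite sieve along [g = f h] with [f] in [r]. By (G2) for [h],
   pulling back along [f] is enough, and that pullback contains the sieve generated by [t f]. *)
apply: (G3 _ _ _ Jr (@is_sieve_generated _ _ _)) => V g [f rf [h /= ->]].
rewrite pullback_sieve_comp; apply: G2.
apply: grothendieck_superset (Jt _ rf) _ _.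
  by apply: is_sieve_pullback; exact: is_sieve_generated.
move=> k [l tl kl]; exists (postcomp (arr f) l).
  by exists f => //; exists l.
exact: factors_through_postcomp.
Qed.

End GrothendieckToSaturated.

Section Inverse.
Variable C : category.

Lemma sieve_closureK (j : collection C) :
  saturated j -> generating_families (sieve_closure j) = j.
Proof.
move=> sj; apply: subcollection_anti => U r.
  (* The sieve of [r] may come from another family in [j]; saturation brings [r] itself back into
     [j]. *)
  by move=> /(sieve_closureE sj)[_ /(saturated_generatedE sj)].
by move=> jr; exists r.
Qed.

Lemma generating_familiesK (J : collection C) :
  is_grothendieck J -> sieve_closure (generating_families J) = J.
Proof.
move=> [G0 _ _ _]; apply: subcollection_anti => U R; first by move=> [r Jr <-].
move=> JR; have RE := generated_sieve_id (G0 _ _ JR).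
by exists R; rewrite /generating_families /= RE.
Qed.

End Inverse.

Theorem proposition6p35 (C : category) :
  exists (F : SatCvg C -> GroCvg C) (G : GroCvg C -> SatCvg C),
    [/\ forall j : SatCvg C, F j = sieve_closure j :> collection C,
        forall J : GroCvg C, G J = generating_families J :> collection C,
        {homo F : j j' / (j <= j')%O},
        {homo G : J J' / (J <= J')%O}
      & cancel F G /\ cancel G F].
Proof.
exists (fun j => MkGroCvg
  (sieve_closure_grothendieck (satcvg_coverage j) (satcvg_saturated j))).
exists (fun J => MkSatCvg
  (generating_families_coverage (grocvg_grothendieck J))
  (generating_families_saturated (grocvg_grothendieck J))).
split=> //.
- move=> j j' /asboolP jj'; apply/asboolP => U _ [r jr <-].
  by exists r => //; exact: jj'.
- by move=> J J' /asboolP JJ'; apply/asboolP => U r; exact: JJ'.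
(* Proof irrelevance reduces equality of bundled coverages to equality of their collections. *)
- split=> [j|J]; first exact/satcvg_inj/sieve_closureK/satcvg_saturated.
  exact/grocvg_inj/generating_familiesK/grocvg_grothendieck.
Qed.
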